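(* For any $n$ and $k$, the statistics $\mathsf{exc}$ and $\mathsf{des}$ are equidistributed on the elements of $\mathsf A_n^k$ in their permutation form, and, respectively, the statistics $\mathsf{inv}$ and $\mathsf{maj}$ are equidistributed on the elements of $\mathsf A_n^k$ in their permutation form.
   Context: $[n]=\{1,\dots,n\}$. For $n\ge1$ and $k\ge1$, a $k$-arrangement of $[n]$ is a pair $(\pi,\phi)$ where $\pi$ is a permutation of $[n]$ and $\phi:\mathsf{Fix}(\pi)\to[k]$ is an arbitrary map on the set $\mathsf{Fix}(\pi)$ of fixed points of $\pi$. A $0$-arrangement of $[n]$ is a derangement of $[n]$ (a permutation without fixed points). For any integer $k\ge0$, the set of $k$-arrangements of $[n]$ is denoted $\mathsf A_n^k$, and $\mathsf A_0^k$ consists of the empty word. The permutation form of an element of $\mathsf A_n^k$ is a word of length $n$ on the alphabet $\{-k+1,\dots,-1,1,2,\dots,n-K\}$, where $K$ is the number of negative letters in the word, and the positive letters appear once each, forming a permutation of $[n-K]$. It is obtained from $(\pi,\phi)$, with $\pi=a_1a_2\ldots a_n$, by replacing $a_i$ by $-\phi(i)$ for each fixed point $i$ of $\pi$ with $\phi(i)\ne k$ (fixed points $i$ with $\phi(i)=k$ are left intact), and then replacing the $j$-th smallest of the remaining positive letters by $j$, for each $j$. For a word $\mathfrak a=a_1\ldots a_n$ of integers, let $s_1\ldots s_n$ be the word consisting of its letters sorted in weakly increasing order. Then $\mathsf{exc}(\mathfrak a)=\#\{i: a_i>s_i\}$; a descent of $\mathfrak a$ is an $i\in[n-1]$ with $a_i>a_{i+1}$;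 $\mathsf{des}(\mathfrak a)$ is the number of descents, and $\mathsf{maj}(\mathfrak a)$ is the sum of the descents; $\mathsf{inv}(\mathfrak a)=\#\{(i,j): i<j,\ a_i>a_j\}$. Two statistics are equidistributed on a finite set if, for each value $v$, they take the value $v$ the same number of times on that set.
   Formalization: The formal theorem assumes k ≥ 1: for k = 0 (derangements, taken as their own permutation form) the claim fails, e.g. for n = 3 the derangements 231, 312 have exc = 2, 1 but des = 1, 1, and inv = 2, 2 but maj = 2, 1. *)

(* Defs.v *)
From HB Require Import structures.
From mathcomp Require Import all_boot all_order all_fingroup all_algebra.

Set Implicit Arguments.
Unset Strict Implicit.
Unset Printing Implicit Defensive.

Import Order.TTheory GRing.Theory Num.Theory.
Local Open Scope ring_scope.

(* Positions and values 1, ..., n are represented by 'I_n (shifted by one), and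
   the color c in {1, ..., k} by the ordinal c - 1 of 'I_k.  For k = 0 a coloring
   exists only when p has no fixed point, so the type is then that of
   derangements; for n = 0 it has exactly one element. *)
Definition arrangement (n k : nat) : finType :=
  {p : 'S_n & {ffun {i : 'I_n | p i == i} -> 'I_k}}.

Section PermutationForm.

Variables (n k : nat) (a : arrangement n k).

(* [insub i] is [Some x], with [val x = i], exactly when i is a fixed point. *)
Definition signed_letter (i : 'I_n) : int :=
  if insub i is Some x then
    let c := (tagged a x).+1 in
    if c == k then i.+1%:Z else - c%:Z
  else (tag a i).+1%:Z.

Definition signed_word : seq int := [seq signed_letter i | i : 'I_n].

(* The positive letters of [signed_word] are distinct, so the number of positive
   letters that are at most x is the rank of x among them. *)
Definition perm_form : seq int :=
  [seq if 0 < x then (count (fun y => 0 < y <= x) signed_word)%:Z else x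
     | x <- signed_word].

End PermutationForm.

Section Statistics.

Variable w : seq int.

Definition exc : nat :=
  let s := sort <=%R w in #|[set i : 'I_(size w) | s`_i < w`_i]|.

(* Descents are numbered from 1: the i-th letter is [w`_i.-1]. *)
Definition descents : seq nat :=
  [seq i <- iota 1 (size w).-1 | w`_i < w`_i.-1].

Definition des : nat := size descents.

Definition maj : nat := sumn descents.

Definition inv_number : nat :=
  #|[set p : 'I_(size w) * 'I_(size w) | (p.1 < p.2)%N && (w`_p.2 < w`_p.1)]|.

End Statistics.

Definition equidistributed (T : finType) (f g : T -> nat) : Prop :=
  forall v : nat, #|[set x | f x == v]| = #|[set x | g x == v]|.

(* Main.v *)
Require Import Defs.
From mathcomp Require Import all_boot all_order all_fingroup all_algebra.
From mathcomp Require Import zify.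

(* The words [perm_form a] form a set closed under rearrangement of letters, and
   [perm_form] is injective, so it suffices to prove MacMahon's theorems on each
   rearrangement class.  For inv and maj this is Foata's second fundamental
   transformation.  For exc and des, insert a maximal letter m into a word w of
   length n with q letters equal to m: among the n + 1 places, both for the usual
   insertion and for "put m at place i and move the letter that was there to the
   end", exactly n - q - stat w increase the statistic by one, and the others
   preserve it.  Each word with q + 1 letters m is obtained q + 1 times, so both
   statistics satisfy the same recurrence. *)

Set Implicit Arguments.
Unset Strict Implicit.
Unset Printing Implicit Defensive.

Import Order.TTheory GRing.Theory Num.Theory.
Local Open Scope ring_scope.

(** * Inversions and major index of a growing word *)

Fixpoint inversions (w : seq int) : nat :=
  if w is x :: w' then (count (fun y => (y < x)%R) w' + inversions w')%N else 0%N.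

Lemma inv_numberE w : inv_number w = inversions w.
Proof.
have -> : inv_number w =
    (\sum_(i < size w) \sum_(j < size w) ((i < j) && (w`_j < w`_i)%R))%N.
  rewrite /inv_number pair_big -sum1_card [LHS]big_mkcond /=.
  by apply: eq_bigr => -[i j] _; rewrite inE /=; case: (_ && _).
elim: w => [|x w IHw]; first by rewrite big_ord0.
rewrite big_ord_recl big_ord_recl /= add0n; congr addn.
  rewrite -sum1_count (big_nth 0) big_mkord [RHS]big_mkcond /=.
  by apply: eq_bigr => i _; case: ifP.
rewrite -IHw; apply: eq_bigr => i _; rewrite big_ord_recl /= add0n.
by apply: eq_bigr => j _.
Qed.

Lemma inversions_rcons w x :
  inversions (rcons w x) = (inversions w + count (fun y => (x < y)%R) w)%N.
Proof.
elim: w => //= y w ->; rewrite -cats1 count_cat /=; lia.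
Qed.

Lemma maj_rcons w x :
  maj (rcons w x) = (maj w + (x < last x w)%R * size w)%N.
Proof.
rewrite /maj /descents size_rcons /=.
case/lastP: w => [|w y]; first by rewrite /= muln0.
rewrite last_rcons size_rcons -pred_Sn -[X in iota 1 X]addn1 iotaD filter_cat sumn_cat.
congr addn.
  congr sumn; apply: eq_in_filter => i; rewrite mem_iota => Hi.
  by rewrite !(nth_rcons _ (rcons _ _)) size_rcons; do 2 (rewrite ifT; last by lia).
rewrite /= add1n !nth_rcons !size_rcons !ltnn !eqxx ltnSn /=.
by case: ifP; rewrite /= ?addn0 ?mul1n.
Qed.

(** * Foata's second fundamental transformation *)

Section FoataRotation.

Variable P : pred int.

(* Cuts the word after each letter satisfying [P] and moves the last letter of
   each block to its front. *)
Fixpoint rotate_blocks (w : seq int) : seq int :=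
  if w is c :: w' then
    if P c then c :: rotate_blocks w'
    else if rotate_blocks w' is d :: u then d :: c :: u else [:: c]
  else [::].

Lemma perm_rotate_blocks w : perm_eq (rotate_blocks w) w.
Proof.
elim: w => //= c w IHw; case: ifP => _; first by rewrite perm_cons.
case: (rotate_blocks w) IHw => [|d u] IHw.
  by rewrite perm_sym in IHw; rewrite (perm_nilP IHw).
by rewrite -(perm_cons c) in IHw; rewrite -(permPr IHw) (perm_catCA [:: d] [:: c]).
Qed.

Lemma size_rotate_blocks w : size (rotate_blocks w) = size w.
Proof. exact/perm_size/perm_rotate_blocks. Qed.

Lemma head_rotate_blocks x w :
  P (last x w) -> w != [::] -> P (head x (rotate_blocks w)).
Proof.
elim: w x => //= c w IHw x Pl _.
case: ifP => //= nPc.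
case: w IHw Pl => [|d w] IHw Pl; first by rewrite Pl in nPc.
have := IHw x Pl isT; have := size_rotate_blocks (d :: w).
by case: (rotate_blocks (d :: w)).
Qed.

(** In the image each letter satisfying [P] opens a block instead of closing it, so complete blocks
    can be read off again. *)
Lemma rotate_blocks_inj x x' w w' : P (last x w) -> P (last x' w') ->
  rotate_blocks w = rotate_blocks w' -> w = w'.
Proof.
(* In the image of [e :: v] a second letter opens a new block and satisfies [P]; in that of
   [e' :: v'] the second letter is [e'], which does not. *)
have mixed e v e' v' : P e -> ~~ P e' -> P (last e v) -> P (last e' v') ->
    rotate_blocks (e :: v) <> rotate_blocks (e' :: v').
  move=> Pe nPe' Pv Pv'; rewrite /= Pe (negbTE nPe').
  have sz := size_rotate_blocks v'.
  case Ev' : (rotate_blocks v') sz => [|d u] sz.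
    by case: v' Pv' sz {Ev'} => //= Pe'; rewrite Pe' in nPe'.
  move=> [_ Ev]; have := @head_rotate_blocks e v Pv.
  rewrite Ev /= (negbTE nPe') => H.
  suff /H : v != [::] by [].
  by case: (v) Ev.
elim: w w' x x' => [|c w IHw] [|c' w'] x x' /=.
- by [].
- by move=> _ _ /(congr1 size)/esym; rewrite (size_rotate_blocks (c' :: w')).
- by move=> _ _ /(congr1 size); rewrite (size_rotate_blocks (c :: w)).
move=> Pw Pw'; have := mixed c w c' w'; have := mixed c' w' c w.
rewrite Pw Pw' /=; case: ifP => Pc'; case: ifP => Pc m1 m2 E.
- by case: E => -> E; rewrite (IHw _ _ _ Pw Pw' E).
- by case: m1.
- by case: m2.
have sz := size_rotate_blocks w; have sz' := size_rotate_blocks w'.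
case Ew : (rotate_blocks w) sz E => [|d u] sz.
  by case: w Pw sz {IHw mixed m1 m2 Ew} => //=; rewrite Pc.
case Ew' : (rotate_blocks w') sz' => [|d' u'] sz'.
  by case: w' Pw' sz' {m1 m2 Ew'} => //=; rewrite Pc'.
case=> Ed Ec Eu; rewrite Ec (IHw w' c c' Pw Pw') // Ew Ew' Ed Eu.
by [].
Qed.

End FoataRotation.

(** A block is a run of letters above [t] closed by one letter at most [t]; moving the latter to the
    front destroys one inversion for each of the former. *)
Lemma inversions_rotate_le (t : int) w : last t w <= t ->
  (inversions (rotate_blocks (fun y => (y <= t)%R) w)
     + count (fun y => (t < y)%R) w)%N = inversions w.
Proof.
elim: w => //= c w IHw lw.
have lw' : last t w <= t by case: (w) lw => //=.
have {IHw} := IHw lw'.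
have pw := perm_rotate_blocks (fun y => y <= t) w.
have hd := @head_rotate_blocks (fun y => y <= t) c w lw.
rewrite -!(seq.permP pw); case: leP => /= ct; first by rewrite (seq.permP pw); lia.
case: (rotate_blocks _ w) pw hd => [|d u] pw hd /=.
  by rewrite perm_sym in pw; move: lw; rewrite (perm_nilP pw) /=; lia.
have /hd /= dt : w != [::] by case: (w) pw => // /perm_size.
rewrite /=.
have -> : (c < d) = false by lia.
have -> : (d < c) by lia.
have -> : (t < d) = false by lia.
lia.
Qed.

(** Here the closing letter is above [t] and the others are not, so the move creates one inversion
    for each of the others. *)
Lemma inversions_rotate_gt (t : int) w : w = [::] \/ t < last t w ->
  inversions (rotate_blocks (fun y => t < y) w) =
  (inversions w + count (fun y => (y <= t)%R) w)%N.
Proof.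
elim: w => //= c w IHw [//|lw].
have lw' : w = [::] \/ t < last t w by case: (w) lw => //=; [left|right].
have {IHw} := IHw lw'.
have pw := perm_rotate_blocks (fun y => t < y) w.
have hd := @head_rotate_blocks (fun y => t < y) c w lw.
rewrite -!(seq.permP pw); case: ltP => /= ct; first by rewrite (seq.permP pw); lia.
case: (rotate_blocks _ w) pw hd => [|d u] pw hd /=.
  by rewrite perm_sym in pw; move: lw; rewrite (perm_nilP pw) /=; lia.
have /hd /= dt : w != [::] by case: (w) pw => // /perm_size.
rewrite /=.
have -> : (c < d) by lia.
have -> : (d < c) = false by lia.
have -> : (d <= t) = false by lia.
lia.
Qed.

(** The comparison with [x] is chosen so that the last letter of a nonempty [u] closes a block. *)
Definition foata_step (u : seq int) (x : int) : seq int :=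
  rcons (rotate_blocks
    (if last x u <= x then fun y => y <= x else fun y => x < y) u) x.

Definition foata (w : seq int) : seq int := foldl foata_step [::] w.

Lemma foata_rcons w x : foata (rcons w x) = foata_step (foata w) x.
Proof. by rewrite /foata -cats1 foldl_cat. Qed.

Lemma last_foata x w : last x (foata w) = last x w.
Proof. by case/lastP: w => // w y; rewrite foata_rcons !last_rcons. Qed.

Lemma perm_foata w : perm_eq (foata w) w.
Proof.
elim/last_ind: w => // w x IHw; rewrite foata_rcons /foata_step -!cats1 perm_cat2r.
by rewrite (permPl (perm_rotate_blocks _ _)).
Qed.

(** The last letter [x] is kept, and the front letter of the rotated word closed a block, so
    comparing it with [x] tells which rotation was used; each one is injective. *)
Lemma foata_inj : injective foata.
Proof.
elim/last_ind=> [|w x IHw] w'; case/lastP: w' => [|w' x'] //.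
- by rewrite foata_rcons => /(congr1 size); rewrite size_rcons.
- by rewrite foata_rcons => /(congr1 size); rewrite size_rcons.
rewrite !foata_rcons => /rcons_inj[E Exx]; move: E; rewrite -{x'}Exx !last_foata => E.
congr rcons; apply: IHw.
have sz : size (foata w) = size (foata w').
  by have := congr1 size E; rewrite !size_rotate_blocks.
have mixed v v' : size (foata v) = size (foata v') ->
    last x v <= x -> x < last x v' ->
    rotate_blocks (fun y => y <= x) (foata v) <>
    rotate_blocks (fun y => x < y) (foata v').
  rewrite -(last_foata x v) -(last_foata x v') => szv lv lv' Ev.
  have v'0 : foata v' != [::] by apply: contraTneq lv' => ->; rewrite ltxx.
  have v0 : foata v != [::] by rewrite -size_eq0 szv size_eq0.
  have := @head_rotate_blocks (fun y => y <= x) x _ lv v0.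
  by rewrite Ev leNgt (@head_rotate_blocks (fun y => x < y) x _ lv' v'0).
move: E; case: leP => lw; case: leP => lw' E.
- by apply: (@rotate_blocks_inj _ x x) E; rewrite last_foata.
- by case: (mixed _ _ sz lw lw').
- by case: (mixed _ _ (esym sz) lw' lw).
- by apply: (@rotate_blocks_inj _ x x) E; rewrite last_foata.
Qed.

(** Appending [x] creates one inversion per letter above [x]. Without a final descent the rotation
    has destroyed as many; with one it has created an inversion per letter at most [x], and the
    total gain is the length, as for [maj]. *)
Lemma inversions_foata w : inversions (foata w) = maj w.
Proof.
elim/last_ind: w => // w x IHw.
rewrite foata_rcons inversions_rcons maj_rcons -IHw -(last_foata x w).
rewrite -(perm_size (perm_foata w)) (seq.permP (perm_rotate_blocks _ _)).
case: leP => lx; first by rewrite inversions_rotate_le //; lia.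
rewrite inversions_rotate_gt; last by case: (foata w) lx; [left|right].
rewrite mul1n -addnA -(count_predC (fun y => y <= x)); congr (_ + (_ + _))%N.
by apply: eq_count => y /=; rewrite -ltNge.
Qed.

(** * Insertion of a letter: double counting and recurrence *)

Definition is_insertion (m : int) (ins : nat -> seq int -> seq int) : Prop :=
  [/\ forall i (w : seq int), (i <= size w)%N -> perm_eq (ins i w) (m :: w),
      forall i (w : seq int), (i <= size w)%N -> (ins i w)`_i = m,
      forall i (w w' : seq int), (i <= size w)%N -> size w = size w' ->
        ins i w = ins i w' -> w = w'
    & forall i (w' : seq int), (i < size w')%N -> w'`_i = m ->
        exists2 w, size w = (size w').-1 & ins i w = w'].

(** Double count of pairs formed by a place i and a word with [m] at i: for fixed i these words are
    the values of [ins i], and each word has as many places as copies of [m]. *)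
Lemma sum_count_insertion m ins (s : seq int) (a : pred (seq int)) : is_insertion m ins ->
  (\sum_(i < (size s).+1) count (fun w => a (ins i w)) (permutations s) =
   (count_mem m s).+1 * count a (permutations (rcons s m)))%N.
Proof.
case=> ins_perm ins_nth ins_inj ins_onto.
have szP w : w \in permutations s -> size w = size s.
  by rewrite mem_permutations => /perm_size.
have imageE i : (i <= size s)%N ->
    perm_eq (map (ins i) (permutations s))
            [seq w <- permutations (rcons s m) | w`_i == m].
  move=> le_is; apply: uniq_perm.
  - rewrite map_inj_in_uniq ?permutations_uniq // => w w' /szP sw /szP sw'.
    by apply: ins_inj; rewrite ?sw ?sw'.
  - by rewrite filter_uniq ?permutations_uniq.
  move=> w; rewrite mem_filter mem_permutations perm_sym perm_rcons.
  apply/mapP/andP => [[u uP ->]|[/eqP wi ws]].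
    have su := szP u uP; rewrite ins_nth ?su // eqxx; split=> //.
    rewrite perm_sym (permPl (ins_perm _ _ _)) ?su // perm_cons.
    by rewrite -mem_permutations.
  have sw := perm_size ws; rewrite /= in sw.
  have [|u su uw] := @ins_onto i w _ wi; first by rewrite -sw.
  exists u => //; rewrite -sw /= in su.
  rewrite mem_permutations -(perm_cons m) perm_sym (permPl ws) -uw.
  by apply: ins_perm; rewrite su.
have countE (i : 'I_(size s).+1) :
    count (fun w => a (ins i w)) (permutations s) =
    (\sum_(w <- permutations (rcons s m)) (a w && (w`_i == m)%R))%N.
  have /seq.permP/(_ a) := imageE i (ltn_ord i).
  rewrite count_map count_filter => ->.
  by rewrite -sum1_count [LHS]big_mkcond; apply: eq_bigr => w _ /=; case: (_ && _).
under eq_bigr do rewrite countE.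
rewrite exchange_big /= -[in RHS](sum1_count _ a) big_distrr /= [RHS]big_mkcond /=.
apply: eq_big_seq => w; rewrite mem_permutations => ws.
case: (a w); last by rewrite big1.
rewrite muln1 /=.
have -> : (count_mem m s).+1 = count_mem m w.
  by rewrite (seq.permP ws) -cats1 count_cat /= eqxx; lia.
rewrite -sum1_count [RHS](big_nth 0) big_mkord (perm_size ws) size_rcons.
by rewrite [RHS]big_mkcond.
Qed.

(** [D] marks the places that raise [f] by one. There are [c - f w] of them, so the right-hand side
    depends only on the distribution of [f] over the rearrangements of [s]. *)
Lemma insertion_recurrence m ins (s : seq int) (f : seq int -> nat) (c v : nat) :
  is_insertion m ins ->
  (forall w : seq int, perm_eq w s -> exists D : nat -> bool,
    (forall i, (i <= size s)%N -> f (ins i w) = (f w + D i)%N) /\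
    (\sum_(i < (size s).+1) D i + f w = c)%N) ->
  ((count_mem m s).+1 * count (fun w => f w == v) (permutations (rcons s m)) =
   \sum_(a <- map f (permutations s))
     ((a == v) * ((size s).+1 - (c - a)) + (a.+1 == v) * (c - a)))%N.
Proof.
move=> ins_ins fD.
rewrite -(sum_count_insertion s (fun w => f w == v) ins_ins) big_map.
under [LHS]eq_bigr do rewrite -sum1_count big_mkcond /=.
rewrite exchange_big /=; apply: eq_big_seq => w.
rewrite mem_permutations => /fD [D [fi sD]].
have -> : (c - f w = \sum_(i < (size s).+1) D i)%N by lia.
rewrite -[X in (X - _)%N](card_ord (size s).+1) -sum1_card -sumnB; last first.
  by move=> i _; apply: leq_b1.
rewrite !big_distrr -big_split /=; apply: eq_bigr => i _.
rewrite fi -1?ltnS //; case: (D i); case: eqVneq; lia.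
Qed.

Lemma equidistributed_insertion m (s : seq int) (f g : seq int -> nat)
    insf insg (c : nat) :
  is_insertion m insf -> is_insertion m insg ->
  (forall w : seq int, perm_eq w s -> exists D : nat -> bool,
    (forall i, (i <= size s)%N -> f (insf i w) = (f w + D i)%N) /\
    (\sum_(i < (size s).+1) D i + f w = c)%N) ->
  (forall w : seq int, perm_eq w s -> exists D : nat -> bool,
    (forall i, (i <= size s)%N -> g (insg i w) = (g w + D i)%N) /\
    (\sum_(i < (size s).+1) D i + g w = c)%N) ->
  perm_eq (map f (permutations s)) (map g (permutations s)) ->
  perm_eq (map f (permutations (rcons s m))) (map g (permutations (rcons s m))).
Proof.
move=> insfP insgP fD gD fg; apply/allP => v _ /=.
rewrite !count_map -(eqn_pmul2l (ltn0Sn (count_mem m s))).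
apply/eqP; rewrite (insertion_recurrence v insfP fD).
by rewrite (insertion_recurrence v insgP gD); apply: perm_big.
Qed.

(** * Two insertions of a letter *)

Definition splice (m : int) (i : nat) (w : seq int) := take i w ++ m :: drop i w.

Lemma is_insertion_splice m : is_insertion m (splice m).
Proof.
split=> [i w _|i w le_iw|i w w' le_iw sw E|i w lt_iw wi].
- by rewrite /splice perm_catC /= perm_cons perm_catC cat_take_drop.
- by rewrite /splice nth_cat size_takel // ltnn subnn.
- move/eqP: E; rewrite eqseq_cat ?size_takel -?sw // => /andP[/eqP t /eqP[d]].
  by rewrite -(cat_take_drop i w) t d cat_take_drop.
exists (take i w ++ drop i.+1 w).
  by rewrite size_cat size_takel ?size_drop ?(ltnW lt_iw) //; lia.
have st : size (take i w) = i by rewrite size_takel // ltnW.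
rewrite /splice take_cat drop_cat st ltnn subnn take0 drop0 cats0 -wi.
by rewrite -drop_nth // cat_take_drop.
Qed.

(** On permutations in one-line notation this inserts the new maximum into the cycle through place
    i, or adds it as a fixed point at the end. *)
Definition replace_append (m : int) (i : nat) (w : seq int) : seq int :=
  if (i < size w)%N then rcons (set_nth 0 w i m) w`_i else rcons w m.

Lemma set_nthK i y (w : seq int) : (i < size w)%N ->
  set_nth 0 (set_nth 0 w i y) i w`_i = w.
Proof.
move=> iw; rewrite set_set_nth eqxx; apply: (@eq_from_nth _ 0) => [|j _].
  by rewrite size_set_nth (maxn_idPr _).
by rewrite nth_set_nth /=; case: eqP => [->|].
Qed.

Lemma is_insertion_replace_append m : is_insertion m (replace_append m).
Proof.
rewrite /replace_append.
split=> [i w _|i w le_iw|i w w' le_iw sw|i w].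
- case: ltnP => iw; rewrite perm_rcons ?perm_refl // set_nthE iw.
  apply/seq.permP => a /=.
  rewrite -[X in _ = (_ + count _ X)%N](cat_take_drop i) (drop_nth 0 iw) !count_cat /=.
  lia.
- case: ltnP => iw; rewrite nth_rcons.
    by rewrite size_set_nth (maxn_idPr iw) iw nth_set_nth /= eqxx.
  by rewrite ltnNge iw /= eqn_leq iw le_iw.
- rewrite -sw; case: ltnP => iw /rcons_inj[] // E1 E2.
  by rewrite -(set_nthK m iw) E1 E2 set_nthK -?sw.
case/lastP: w => // w y; rewrite size_rcons ltnS nth_rcons /= => le_iw.
case: ltnP => iw.
  move=> wi; have sw : size (set_nth 0 w i y) = size w.
    by rewrite size_set_nth (maxn_idPr iw).
  exists (set_nth 0 w i y); rewrite sw // iw -wi set_nthK //.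
  by rewrite nth_set_nth /= eqxx.
have -> : i == size w by rewrite eqn_leq iw le_iw.
by move=> ->; exists w; rewrite // ltnNge iw.
Qed.

(** * Descents and excedances under insertion *)

Fixpoint descent_number (w : seq int) : nat :=
  if w is x :: w' then ((head x w' < x)%R + descent_number w')%N else 0%N.

Lemma desE w : des w = descent_number w.
Proof.
rewrite /des /descents; elim: w => // x [|y w] IHw; first by rewrite /= ltxx.
transitivity ((y < x)%R + descent_number (y :: w))%N => [|//].
rewrite -IHw /= -[2%N]add1n iotaDl filter_map.
have -> : [seq i <- iota 1 (size w) | preim (addn 1)
    (fun i => [:: x, y & w]`_i < [:: x, y & w]`_i.-1) i] =
  [seq i <- iota 1 (size w) | (y :: w)`_i < (y :: w)`_i.-1].
  by apply: eq_in_filter => -[|i] //; rewrite mem_iota.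
by case: ifP => _ /=; rewrite size_map.
Qed.

Lemma descent_number_sum w :
  descent_number w = (\sum_(i < size w) ((0 < i) && (w`_i < w`_i.-1)%R))%N.
Proof.
elim: w => [|x w IHw]; first by rewrite big_ord0.
rewrite big_ord_recl /= add0n IHw.
case: w {IHw} => [|y w]; first by rewrite !big_ord0 ltxx.
by rewrite !big_ord_recl.
Qed.

(** A descent between places i - 1 and i is broken, and one arises after [m] if the next letter is
    below [m]; the step up to the maximal letter [m] is no descent. *)
Lemma descent_number_splice m i w : all (fun x => x <= m) w -> (i <= size w)%N ->
  (descent_number (splice m i w) + ((0 < i < size w) && (w`_i < w`_i.-1)%R) =
   descent_number w + ((i < size w) && (w`_i < m)%R))%N.
Proof.
rewrite /splice; elim: w i => [|x w IHw] [|i] //=.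
- by rewrite ltxx.
- by move=> _ _; lia.
case/andP=> xm wm; rewrite ltnS => iw.
have := IHw i wm iw; case: i iw => [|i] iw; last first.
  have -> : head x (take i.+1 w ++ m :: drop i.+1 w) = head x w by case: (w) iw.
  by move=> /=; lia.
rewrite /= take0 drop0 /=.
case: (w) wm => [|y v] /=; first by rewrite ltxx; lia.
case/andP=> ym _; lia.
Qed.

Lemma exc_sorted (w s : seq int) : sorted <=%R s -> perm_eq w s ->
  exc w = (\sum_(i < size s) (s`_i < w`_i)%R)%N.
Proof.
move=> ss ws; rewrite /exc.
have -> : sort <=%R w = s.
  apply: (sorted_eq le_trans le_anti) => //; first exact: (sort_sorted le_total).
  by rewrite perm_sort.
rewrite -sum1_card big_mkcond (perm_size ws) /=.
by apply: eq_bigr => i _; rewrite inE; case: (_ < _).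
Qed.

Lemma count_lt_nth (m : int) (s : seq int) :
  count (fun x => x < m) s = (\sum_(i < (size s).+1) ((i < size s) && (s`_i < m)%R))%N.
Proof.
rewrite big_ord_recr /= ltnn addn0 -sum1_count (big_nth 0) big_mkord big_mkcond.
by apply: eq_bigr => i _; rewrite ltn_ord /=; case: (_ < _).
Qed.

(** For a place with sorted letter [a]: replacing the letter [b] by the maximal [c] keeps an
    excedance, and creates one if [a] is below [c] but not below [b]. *)
Lemma lt_split (a b c : int) : b <= c ->
  (a < c) = ((a < b)%R + ((a < c)%R && ~~ (a < b)%R))%N :> nat.
Proof. by move=> bc; case: (ltP a b) => ab; rewrite ?(lt_le_trans ab bc) ?andbT. Qed.

(** Induction along the sorted word: its last letter [m] is maximal, so the earlier places keep
    their sorted letters and the new last place is never an excedance. *)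
Lemma perm_exc_des (s : seq int) :
  perm_eq (map exc (permutations s)) (map des (permutations s)).
Proof.
wlog ss : s / sorted <=%R s.
  move=> IH; have E := perm_permutations (permEl (perm_sort <=%R s)).
  rewrite -(permPl (perm_map exc E)) -(permPr (perm_map des E)).
  exact/IH/(sort_sorted le_total).
elim/last_ind: s ss => [_|s m IHs ssm].
  suff /eq_in_map-> : {in permutations [::], exc =1 des} by [].
  move=> w; rewrite mem_permutations => /perm_nilP->.
  by rewrite (@exc_sorted [::] [::]) ?big_ord0.
have ss : sorted <=%R s by move: ssm; rewrite -cats1 => /cat_sorted2[].
have sm : all (fun x => x <= m) s.
  have: sorted >=%R (rev (rcons s m)) by rewrite rev_sorted.
  rewrite rev_rcons /= (path_sortedE ge_trans) all_rev => /andP[].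
  by [].
(* The constant is the number of letters of [s] below [m]. *)
apply: (@equidistributed_insertion m s exc des _ _ (count (fun x => x < m) s)
  (is_insertion_replace_append m) (is_insertion_splice m)); last exact: IHs.
- move=> w ws; have sw := perm_size ws.
  have wm i : (i < size s)%N -> w`_i <= m.
    by rewrite -sw => iw; apply: (allP sm); rewrite -(perm_mem ws) mem_nth.
  exists (fun i => (i < size s)%N && (s`_i < m) && ~~ (s`_i < w`_i)); split.
    move=> i le_is; rewrite (exc_sorted ss ws).
    have wsm : perm_eq (replace_append m i w) (rcons s m).
      have [H _ _ _] := is_insertion_replace_append m.
      by rewrite (permPl (H _ _ _)) ?sw // perm_sym perm_rcons perm_cons perm_sym.
    rewrite (exc_sorted ssm wsm) size_rcons big_ord_recr /=.
    rewrite nth_rcons ltnn eqxx.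
    have -> : (m < (replace_append m i w)`_(size s)) = false.
      rewrite ltNge /replace_append sw; case: ltnP => iw.
        rewrite nth_rcons size_set_nth sw (maxn_idPr iw) ltnn eqxx.
        by rewrite wm.
      by rewrite nth_rcons sw ltnn eqxx lexx.
    rewrite addn0 /replace_append sw.
    have nthE (j : 'I_(size s)) : (rcons s m)`_j = s`_j by rewrite nth_rcons ltn_ord.
    under eq_bigr do rewrite nthE.
    case: ltnP => iw /=; last first.
      by rewrite addn0; apply: eq_bigr => j _; rewrite nth_rcons sw ltn_ord.
    have nthE' (j : 'I_(size s)) :
        (rcons (set_nth 0 w i m) w`_i)`_j = if j == i :> nat then m else w`_j.
      by rewrite nth_rcons size_set_nth sw (maxn_idPr iw) ltn_ord nth_set_nth.
    under eq_bigr do rewrite nthE'.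
    rewrite (bigD1 (Ordinal iw)) //= eqxx [in RHS](bigD1 (Ordinal iw)) //=.
    rewrite addnAC; congr addn; first exact/lt_split/wm.
    by apply: eq_bigr => j; rewrite -val_eqE /= => /negbTE ->.
  rewrite (exc_sorted ss ws) count_lt_nth !big_ord_recr /= ltnn !addn0 -big_split.
  by apply: eq_bigr => j _ /=; rewrite ltn_ord addnC -lt_split // wm.
move=> w ws; have sw := perm_size ws.
have aw : all (fun x => x <= m) w by rewrite (perm_all _ ws).
have wm i : (i < size s)%N -> w`_i <= m.
  by rewrite -sw => iw; apply: (allP aw); rewrite mem_nth.
(* [B i] says that place i, counted from 0, is the lower end of a descent; inserting [m] there
   trades this descent for a new one. *)
pose B i := (0 < i < size w)%N && (w`_i < w`_i.-1).
have BC i : B i -> (i < size w)%N && (w`_i < m).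
  case/andP=> /andP[_ iw] lt_i; rewrite iw /=; apply: lt_le_trans lt_i (wm _ _).
  by rewrite -sw (leq_ltn_trans (leq_pred i)).
exists (fun i => (i < size w)%N && (w`_i < m) && ~~ B i); split.
  move=> i; rewrite -sw !desE => le_iw.
  have := descent_number_splice aw le_iw; rewrite -/(B i).
  by case: (B i) (BC i) => [/(_ isT)->|_] /=; rewrite ?andbT; lia.
rewrite desE descent_number_sum -(seq.permP ws) count_lt_nth -sw.
have -> : (\sum_(i < size w) ((0 < i) && (w`_i < w`_i.-1)%R) =
           \sum_(i < (size w).+1) B i)%N.
  rewrite big_ord_recr /= /B ltnn andbF addn0.
  by apply: eq_bigr => i _; rewrite ltn_ord andbT.
rewrite -big_split; apply: eq_bigr => i _ /=.
by case: (B i) (BC i) => [/(_ isT)->|_] /=; rewrite ?andbT ?addn0.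
Qed.

(** Foata's map is injective from the finite rearrangement class to itself, hence bijective. *)
Lemma perm_inv_number_maj (s : seq int) :
  perm_eq (map inv_number (permutations s)) (map maj (permutations s)).
Proof.
have <- : map inversions (map foata (permutations s)) = map maj (permutations s).
  by rewrite -map_comp; apply: eq_map => w; apply: inversions_foata.
rewrite (eq_map inv_numberE); apply: perm_map; rewrite perm_sym.
have foata_uniq : uniq (map foata (permutations s)).
  by rewrite (map_inj_uniq foata_inj) permutations_uniq.
suff sub : {subset map foata (permutations s) <= permutations s}.
  rewrite uniq_perm ?permutations_uniq //.
  by have [|_ E x] := uniq_min_size foata_uniq sub; rewrite ?size_map ?E.
move=> _ /mapP[w ws ->]; move: ws; rewrite !mem_permutations.
exact/perm_trans/perm_foata.
Qed.

(** * From rearrangement classes to closed sets of words *)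

(** A closed list splits into the class of its first word and a shorter list that is again
    closed. *)
Lemma perm_map_closed (f g : seq int -> nat) (L : seq (seq int)) :
  (forall s, perm_eq (map f (permutations s)) (map g (permutations s))) ->
  uniq L -> (forall u w, u \in L -> perm_eq w u -> w \in L) ->
  perm_eq (map f L) (map g L).
Proof.
move=> fg; have [n] := ubnP (size L); elim: n L => // n IHn [//|w L] szL uL cL.
set L' := w :: L in szL uL cL *.
have split_class := permEl (perm_filterC (perm_eq^~ w) L').
rewrite -(permPl (perm_map f split_class)) -(permPr (perm_map g split_class)).
rewrite !map_cat; apply: perm_cat.
  have classE : perm_eq [seq u <- L' | perm_eq u w] (permutations w).
    apply: uniq_perm; rewrite ?filter_uniq ?permutations_uniq // => u.
    rewrite mem_filter mem_permutations; apply: andb_idr => uw.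
    by apply: cL uw; rewrite mem_head.
  by rewrite (permPl (perm_map f classE)) (permPr (perm_map g classE)).
apply: IHn; rewrite ?filter_uniq //.
  rewrite /L' /= perm_refl /= -ltnS; apply: leq_ltn_trans szL.
  by rewrite ltnS size_filter count_size.
move=> u v; rewrite !mem_filter /= => /andP[nuw uL'] vu; rewrite (cL u) // andbT.
by apply: contra nuw => vw; rewrite perm_sym in vu; apply: perm_trans vu vw.
Qed.

Lemma card_count (T : finType) (P : pred T) : #|[set x | P x]| = count P (enum T).
Proof. by rewrite cardsE cardE enumT -size_filter. Qed.

Lemma equidistributed_comp (T : finType) (h : T -> seq int)
    (f g : seq int -> nat) :
  (forall s, perm_eq (map f (permutations s)) (map g (permutations s))) ->
  injective h -> (forall x w, perm_eq w (h x) -> exists y, h y = w) ->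
  equidistributed (fun x => f (h x)) (fun x => g (h x)).
Proof.
move=> fg h_inj h_closed v.
have cardE (q : seq int -> nat) :
    #|[set x | q (h x) == v]| = count (pred1 v) (map q (map h (enum T))).
  by rewrite card_count -map_comp [RHS]count_map.
rewrite !cardE; apply/seq.permP/perm_map_closed => //.
  by rewrite (map_inj_uniq h_inj) enum_uniq.
move=> _ w /mapP[x _ ->] /h_closed[y <-].
by rewrite map_f ?mem_enum.
Qed.

(** * Ranks in a finite set *)

Section Rank.

Variables (n : nat) (S : {set 'I_n}).

Definition rank (j : nat) : nat := #|[set i in S | (i <= j)%N]|.

Lemma rank_lt (i j : 'I_n) : j \in S -> (i < j)%N -> (rank i < rank j)%N.
Proof.
move=> Sj lt_ij; apply: proper_card; apply/properP; split.
  by apply/subsetP => l; rewrite !inE => /andP[-> /leq_trans->] //; apply: ltnW.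
by exists j; rewrite !inE Sj ?leqnn //= -ltnNge.
Qed.

Lemma rank_inj : {in S &, injective (fun i : 'I_n => rank i)}.
Proof.
move=> i j Si Sj E; apply: val_inj; case: (ltngtP i j) => // lt.
  by have := rank_lt Sj lt; rewrite E ltnn.
by have := rank_lt Si lt; rewrite E ltnn.
Qed.

Lemma rank_gt0 (i : 'I_n) : i \in S -> (0 < rank i)%N.
Proof. by move=> Si; apply/card_gt0P; exists i; rewrite inE Si /=. Qed.

Lemma rank_le_card j : (rank j <= #|S|)%N.
Proof. by apply/subset_leq_card/subsetP => i; rewrite inE => /andP[]. Qed.

Lemma rank_onto r : (0 < r <= #|S|)%N -> exists2 j : 'I_n, j \in S & rank j = r.
Proof.
pose ranks := [seq rank i | i : 'I_n in S].
have ranks_uniq : uniq ranks.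
  by rewrite map_inj_in_uniq ?enum_uniq // => i j; rewrite !mem_enum; apply: rank_inj.
have sub : {subset ranks <= iota 1 #|S|}.
  move=> _ /imageP[i Si ->].
  by rewrite mem_iota rank_gt0 //= add1n ltnS rank_le_card.
have [|_ ranksE] := uniq_min_size ranks_uniq sub.
  by rewrite size_iota size_image.
move=> r_range; have : r \in ranks by rewrite ranksE mem_iota add1n ltnS.
by case/imageP=> j Sj ->; exists j.
Qed.

End Rank.

(** * Letters of the permutation form and injectivity *)

Section SignedLetters.

Variables (n k : nat) (a : arrangement n k).

Lemma signed_letter_gt0 i : 0 < signed_letter a i ->
  signed_letter a i = (tag a i).+1%:Z.
Proof.
rewrite /signed_letter; case: insubP => [x /eqP pi xi|//].
by case: ifP => //; rewrite pi.
Qed.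

Lemma signed_letter_le0 i : ~~ (0 < signed_letter a i) ->
  tag a i = i /\ (- k%:Z < signed_letter a i < 0).
Proof.
rewrite /signed_letter; case: insubP => [x /eqP pi xi|//].
have := ltn_ord (tagged a x); case: eqP => // neq lt _; split=> //; lia.
Qed.

(** Non-positive letters sit at fixed points, so the permutation preserves the set of places with
    positive letters; up to the shift by one, it is also the set of their values. *)
Lemma signed_letter_gt0_tag i :
  (0 < signed_letter a (tag a i)) = (0 < signed_letter a i).
Proof.
apply/idP/idP; apply: contraTT => H; first by have [-> _] := signed_letter_le0 H.
have [/perm_inj E _] := signed_letter_le0 H.
by rewrite -E.
Qed.

Definition positives : {set 'I_n} := [set i | 0 < signed_letter a i].

Lemma perm_formE : perm_form a =
  [seq if 0 < signed_letter a i then (rank positives (tag a i))%:Z else signed_letter a i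
     | i <- enum 'I_n].
Proof.
rewrite /perm_form /signed_word -map_comp; apply: eq_map => i /=.
case: ifP => // posi; congr Posz.
rewrite signed_letter_gt0 // count_map /rank.
rewrite -(card_preimset _ (@perm_inj _ (tag a))) card_count.
apply: eq_count => j /=; rewrite !inE signed_letter_gt0_tag.
by case: ltP => // posj; rewrite signed_letter_gt0.
Qed.

Lemma size_perm_form : size (perm_form a) = n.
Proof. by rewrite perm_formE size_map size_enum_ord. Qed.

Lemma nth_perm_form (i : 'I_n) : (perm_form a)`_i =
  if 0 < signed_letter a i then (rank positives (tag a i))%:Z else signed_letter a i.
Proof.
by rewrite perm_formE (nth_map i) ?size_enum_ord // nth_ord_enum.
Qed.

Lemma perm_form_gt0 (i : 'I_n) : (0 < (perm_form a)`_i) = (0 < signed_letter a i).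
Proof.
rewrite nth_perm_form; case: ifP => // posi.
by rewrite ltz_nat rank_gt0 // inE signed_letter_gt0_tag.
Qed.

End SignedLetters.

(** The signs give the set of positive places, on which ranks determine the permutation; the other
    places are fixed. At a fixed point a negative letter shows its colour, and a positive one means
    colour [k]. *)
Lemma perm_form_inj n k : injective (@perm_form n k).
Proof.
move=> a b E.
have pos_eq i : (0 < signed_letter a i) = (0 < signed_letter b i).
  by rewrite -!perm_form_gt0 E.
have positives_eq : positives b = positives a.
  by apply/setP => i; rewrite !inE pos_eq.
have letter_eq i : signed_letter a i = signed_letter b i.
  have := nth_perm_form a i; rewrite E nth_perm_form -pos_eq.
  case: ifP => // posi [].
  have posb : 0 < signed_letter b i by rewrite -pos_eq.
  rewrite (signed_letter_gt0 posi) (signed_letter_gt0 posb) positives_eq => Er.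
  rewrite (rank_inj _ _ Er) // inE ?signed_letter_gt0_tag //.
  by rewrite pos_eq signed_letter_gt0_tag.
have tag_eq : tag a = tag b.
  apply/permP => i; have := letter_eq i; case: (boolP (0 < signed_letter a i)) => posi.
    have posb : 0 < signed_letter b i by rewrite -pos_eq.
    by rewrite (signed_letter_gt0 posi) (signed_letter_gt0 posb) => -[] /val_inj.
  have [-> _] := signed_letter_le0 posi.
  by rewrite pos_eq in posi; have [-> _] := signed_letter_le0 posi.
case: a b tag_eq {E positives_eq} pos_eq letter_eq => [p c] [q d] /= pq.
subst q => _ letter_eq.
congr existT; apply/ffunP => x; have := letter_eq (val x).
rewrite /signed_letter !valK /=; have := ltn_ord (c x); have := ltn_ord (d x).
by do 2 case: eqP; move=> *; apply: val_inj => /=; lia.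
Qed.

(** * Characterization of the permutation forms *)

Lemma count_nth_ord n (w : seq int) (P : pred int) : size w = n ->
  count P w = #|[set i : 'I_n | P w`_i]|.
Proof.
move=> <-; rewrite card_count -{1}[w](mkseq_nth 0) /mkseq -val_enum_ord.
by rewrite -map_comp count_map.
Qed.

(* The words [perm_form a], described so that invariance under rearrangement is
   visible: the positive letters are distinct and bounded by their number. *)
Definition admissible (k : nat) (w : seq int) : bool :=
  all (fun x => if 0 < x
                then (x <= (count (fun y => (0 < y)%R) w)%:Z) && (count_mem x w <= 1)%N
                else - k%:Z < x < 0) w.

Lemma perm_admissible k u w : perm_eq u w -> admissible k u = admissible k w.
Proof.
move=> uw; rewrite /admissible (perm_all _ uw); apply: eq_all => x.
by rewrite !(seq.permP uw).
Qed.

Lemma perm_form_admissible n k (a : arrangement n k) : admissible k (perm_form a).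
Proof.
apply/(all_nthP 0) => _i; rewrite size_perm_form => lt_in.
pose i := Ordinal lt_in; rewrite -[_i]/(val i) perm_form_gt0.
rewrite !(count_nth_ord _ (size_perm_form a)).
case: ifP => [posi|/negbT posi]; last first.
  rewrite nth_perm_form (negbTE posi).
  by have [_] := signed_letter_le0 posi.
rewrite nth_perm_form posi; apply/andP; split.
  rewrite lez_nat (leq_trans (rank_le_card _ _)) //.
  by apply/subset_leq_card/subsetP => j; rewrite !inE perm_form_gt0.
rewrite -(cards1 i); apply/subset_leq_card/subsetP => j; rewrite !inE /=.
have posE : (0 < (perm_form a)`_j) = (0 < signed_letter a j) := perm_form_gt0 a j.
move=> /eqP E; have posj : 0 < signed_letter a j.
  by rewrite -posE E ltz_nat rank_gt0 // inE signed_letter_gt0_tag.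
move: E; rewrite nth_perm_form posj => -[] /rank_inj E; apply/eqP.
by apply: (@perm_inj _ (tag a)); apply: E; rewrite inE signed_letter_gt0_tag.
Qed.

(** Each positive letter is the rank of a unique element of the set [S] of positive places; the
    permutation sends its place to that element and fixes the places outside [S]. *)
Lemma admissible_perm_form n k w : size w = n -> admissible k.+1 w ->
  exists a : arrangement n k.+1, perm_form a = w.
Proof.
move=> sw /(all_nthP 0) adm.
pose S := [set i : 'I_n | 0 < w`_i].
have Sw (i : 'I_n) : i \in S -> exists2 j, j \in S & (rank S j)%:Z = w`_i.
  rewrite inE => posi; have := adm i; rewrite sw posi => /(_ (ltn_ord i))/andP[wi _].
  rewrite (count_nth_ord _ sw) -/S in wi.
  case: (w`_i) posi wi => // r; rewrite ltz_nat lez_nat => r_gt0 le_r.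
  by have [|j Sj <-] := @rank_onto _ S r; [rewrite r_gt0 | exists j].
have w_inj (i j : 'I_n) : i \in S -> w`_i = w`_j -> i = j.
  rewrite inE => posi E; have := adm i; rewrite sw posi => /(_ (ltn_ord i))/andP[_].
  rewrite (count_nth_ord _ sw) => /card_le1_eqP; apply; rewrite inE /= ?E //.
pose s (i : 'I_n) := if [pick j in S | (rank S j)%:Z == w`_i] is Some j then j else i.
have sS (i : 'I_n) : i \in S -> s i \in S /\ (rank S (s i))%:Z = w`_i.
  move=> /Sw[j Sj rj]; rewrite /s; case: pickP => [l /andP[Sl /eqP] //|/(_ j)].
  by rewrite Sj rj eqxx.
have sNS (i : 'I_n) : i \notin S -> s i = i.
  rewrite inE -leNgt /s => npi; case: pickP => // l /andP[Sl /eqP E].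
  by have := rank_gt0 Sl; lia.
have s_inj : injective s.
  move=> i j; have [Si|Si] := boolP (i \in S); have [Sj|Sj] := boolP (j \in S) => E.
  - by apply: w_inj => //; rewrite -(sS i Si).2 -(sS j Sj).2 E.
  - by have [] := sS i Si; rewrite E sNS // (negbTE Sj).
  - by have [] := sS j Sj; rewrite -E sNS // (negbTE Si).
  - by rewrite !sNS in E.
(* Colour c is stored as c - 1: a positive letter gets [k], the top colour, which leaves a fixed
   point intact, and a letter -c gets c - 1. *)
pose color (i : 'I_n) : 'I_k.+1 := inord (if 0 < w`_i then k else (absz w`_i).-1).
pose a : arrangement n k.+1 :=
  Tagged (fun p : 'S_n => {ffun {i : 'I_n | p i == i} -> 'I_k.+1})
    [ffun x : {i : 'I_n | perm s_inj i == i} => color (val x)].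
have letterE i : signed_letter a i = if 0 < w`_i then (s i).+1%:Z else w`_i.
  rewrite /signed_letter; case: insubP => [x /eqP fixi xi|nfix] /=.
    rewrite ffunE xi /color; move: fixi; rewrite permE => ->.
    case: (boolP (0 < w`_i)) => posi; first by rewrite inordK ?eqxx.
    have := adm i; rewrite sw (negbTE posi) => /(_ (ltn_ord i)).
    case: (w`_i) => [r|r] /andP[] //.
    rewrite NegzE ltrN2 ltz_nat => lt_rk _.
    by rewrite /= inordK ?(ltnW lt_rk) // ltn_eqF.
  rewrite permE; case: ifP => // posi.
  by move: nfix; rewrite permE sNS ?eqxx // inE posi.
have pos_letterE i : (0 < signed_letter a i) = (0 < w`_i).
  by rewrite letterE; case: ifP.
have positivesE : positives a = S by apply/setP => i; rewrite !inE pos_letterE.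
exists a; apply: (@eq_from_nth _ 0) => [|i]; rewrite size_perm_form ?sw // => lt_in.
have -> : i = val (Ordinal lt_in) by [].
rewrite nth_perm_form pos_letterE positivesE letterE.
case: (boolP (0 < w`_(Ordinal lt_in))) => // posi.
by rewrite permE (sS _ _).2 // inE.
Qed.

Theorem proposition5 (n k : nat) (hk : (0 < k)%N) :
  equidistributed (fun a : arrangement n k => exc (perm_form a))
                  (fun a : arrangement n k => des (perm_form a))
  /\
  equidistributed (fun a : arrangement n k => inv_number (perm_form a))
                  (fun a : arrangement n k => maj (perm_form a)).
Proof.
(* Without colours the equidistribution fails: on the derangements 231 and 312, [exc] takes the
   values 2 and 1, but [des] is 1 on both. *)
case: k hk => // k _.
have closed (a : arrangement n k.+1) w : perm_eq w (perm_form a) ->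
    exists b : arrangement n k.+1, perm_form b = w.
  move=> wa; apply: admissible_perm_form; first by rewrite (perm_size wa) size_perm_form.
  by rewrite (perm_admissible _ wa) perm_form_admissible.
split; apply: equidistributed_comp closed => //.
- exact: perm_exc_des.
- exact: perm_form_inj.
- exact: perm_inv_number_maj.
- exact: perm_form_inj.
Qed.
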